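(* Let $\Omega$ be an open, bounded, connected subset of $\mathbb{R}^N$ with $C^2$ boundary and $M=(M_i)_{i=1}^{m-1}$ a connected minimal $m$-phase partitioning of $\Omega$ with volume constancy constraint. Then $M$ is stable if and only if each $M_i$ $(i=1,\dots,m-1)$ is stable. $M$ is unstable if and only if there is at least one unstable $M_i$ $(i=1,\dots,m-1)$.
   Context: Partitioning: a finite collection $M=(M_i)$ of pairwise non-intersecting (compact) $C^2$ hypersurfaces with $C^2$ boundary, contained in $\overline\Omega$, with $\partial M_i\subset\Sigma=\partial\Omega$. The $M_i$ (interfaces) divide $\Omega$ into sets assigned to $m$ phases; each $M_i$ separates two such sets of different phases and is oriented by a unit normal $N_i$. The partitioning is connected if no phase is split, i.e. each phase is one connected set (so there are $m$ sets and $m-1$ interfaces). The area functional is $A(M)=\sum_i\gamma_iA(M_i)$ with constants $\gamma_i>0$. $M$ is minimal if the first variation of $A(M)$ vanishes for all variations (flows of vector fields tangent to $\Sigma$ on $\Sigma$) preserving the volumes of all phases. For a minimal connected partitioning, the second variation of area for a normal variation $w$ with $f_i=w\cdot N_i$ is $$J(f_1,\dots,f_{m-1})=\sum_{i=1}^{m-1}\gamma_i\left[\int_{M_i}\left(|\nabla^{M_i}f_i|^2-|B_{M_i}|^2f_i^2\right)-\int_{\partial M_i}\sigma_if_i^2\right],$$ and the volume constraints are $\int_{M_i}f_i=0$ for $i=1,\dots,m-1$. Here $|B_{M_i}|$ is the norm of the second fundamental form of $M_i$ and $\sigma_i=II_\Sigma(N_i,N_i)$, with $II_\Sigma(u,v)=\langle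 N_\Sigma,D_uv\rangle$, $N_\Sigma$ the inward unit normal of $\Sigma$. $M$ is stable if $J>0$ for all admissible $(f_1,\dots,f_{m-1})\neq0$ (those satisfying the volume constraints), and unstable if $J<0$ for some admissible $(f_1,\dots,f_{m-1})$. An individual $M_i$ is stable (unstable) if it is so as a two-phase partitioning of $\Omega$, i.e. $J_i(f)=\int_{M_i}(|\nabla^{M_i}f|^2-|B_{M_i}|^2f^2)-\int_{\partial M_i}\sigma_if^2$ is positive for all $f\neq0$ with $\int_{M_i}f=0$ (negative for some $f$ with $\int_{M_i}f=0$). *)

(* Defs.v *)
From HB Require Import structures.
From mathcomp Require Import all_boot all_order all_algebra.
From mathcomp Require Import all_classical all_reals all_analysis.
Import Order.TTheory GRing.Theory Num.Theory.
Import numFieldNormedType.Exports.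

Set Implicit Arguments.
Unset Strict Implicit.
Unset Printing Implicit Defensive.

Local Open Scope classical_set_scope.
Local Open Scope ring_scope.

(* The ambient space R^N is 'rV[R]_n.+1, with N = n.+1. The norm that the
   library puts on it is the sup norm: it is used only for the topology, for
   boundedness and for differentiation; lengths, angles and diameters are
   Euclidean, through dot. *)

Section euclidean.
Context {R : realType} {N : nat}.
Implicit Types u v : 'rV[R]_N.

Definition dot u v : R := \sum_i u 0 i * v 0 i.

Definition enorm u : R := Num.sqrt (dot u u).

Definition basis_vec (i : 'I_N) : 'rV[R]_N := delta_mx 0 i.

(* orthogonal projection onto the hyperplane with unit normal nu *)
Definition tproj (nu v : 'rV[R]_N) : 'rV[R]_N := v - dot v nu *: nu.

Definition ediam (A : set 'rV[R]_N) : \bar R :=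
  ereal_sup [set (enorm (xy.1 - xy.2))%:E | xy in A `*` A].

End euclidean.

Section hausdorff.
Context {R : realType} {n : nat}.
Local Notation V := 'rV[R]_n.+1.
Local Open Scope ereal_scope.

(* volume of the unit ball of R^d: w_0 = 1, w_1 = 2, w_(d+2) = 2 pi w_d/(d+2) *)
Fixpoint ball_volume (d : nat) : R :=
  match d with
  | 0 => 1%R
  | 1 => 2%R
  | d'.+2 => (2 * pi / d'.+2%:R * ball_volume d')%R
  end.

Lemma ball_volume_ge0 d : (0 <= ball_volume d)%R.
Proof.
suff: (0 <= ball_volume d)%R /\ (0 <= ball_volume d.+1)%R by case.
elim: d => [|d [h1 h2]]; first by split => /=.
split => //=; rewrite mulr_ge0// divr_ge0// mulr_ge0//; exact: pi_ge0.
Qed.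

Definition gauge (d : nat) (A : set V) : \bar R :=
  if `[< A = set0 >] then 0
  else (ball_volume d * (fine (ediam A) / 2) ^+ d)%:E.

Definition hausdorff_cover (delta : R) (A : set V) : set ((set V)^nat) :=
  [set C | (forall i, ediam (C i) <= delta%:E) /\ A `<=` \bigcup_i C i].

Definition hausdorff_pre (d : nat) (delta : R) (A : set V) : \bar R :=
  ereal_inf [set \sum_(i <oo) gauge d (C i) | C in hausdorff_cover delta A].

(* d-dimensional Hausdorff outer measure; with this normalization it is the
   Lebesgue measure for d = n.+1 and the area on C^1 d-dimensional surfaces *)
Definition hausdorff (d : nat) (A : set V) : \bar R :=
  ereal_sup [set hausdorff_pre d delta A | delta in [set e : R | (0 < e)%R]].

Lemma fine_ediam_ge0 (A : set V) : (0 <= fine (ediam A))%R.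
Proof.
have [->|/set0P[x Ax]] := eqVneq A set0.
  by rewrite /ediam set0X image_set0 ereal_sup0.
apply: fine_ge0; apply: (@le_trans _ _ (enorm (x - x))%:E).
  by rewrite lee_fin sqrtr_ge0.
by apply: ereal_sup_ubound; exists (x, x).
Qed.

Lemma gauge_ge0 d (A : set V) : 0 <= gauge d A.
Proof.
rewrite /gauge; case: ifP => // _.
by rewrite lee_fin mulr_ge0 ?ball_volume_ge0// exprn_ge0// divr_ge0 ?fine_ediam_ge0.
Qed.

Let T := g_sigma_algebraType [set: set V].

Let cut d (delta : R) (A : set T) : \bar R :=
  if ediam (A : set V) <= delta%:E then gauge d A else +oo.

Let cut_ge0 d delta A : 0 <= cut d delta A.
Proof. by rewrite /cut; case: ifP => // _; exact: gauge_ge0. Qed.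

Let cut0 d delta : (0 < delta)%R -> cut d delta set0 = 0.
Proof.
move=> d0; rewrite /cut /gauge; case: ifP => [_|].
  by case: asboolP.
by rewrite /ediam set0X image_set0 ereal_sup0 leNye.
Qed.

Let preE d delta : (0 < delta)%R ->
  hausdorff_pre d delta = @mu_ext _ T R (cut d delta).
Proof.
move=> d0; apply/funext => A; apply/eqP; rewrite eq_le; apply/andP; split.
  apply: le_ereal_inf_tmp => _ [C [_ AC] <-].
  have [h|] := pselect (forall i, ediam (C i : set V) <= delta%:E).
    apply: ereal_inf_lbound; exists C => //.
    by apply: eq_eseriesr => i _; rewrite /cut h.
  move=> /existsNP[i /negP hi].
  rewrite (@eseries_pinfty _ _ _ i) ?leey// /cut ?(negbTE hi)//.
  by move=> k _; rewrite -ltNye (lt_le_trans _ (cut_ge0 d delta (C k))).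
apply: le_ereal_inf_tmp => _ [C [hC AC] <-].
apply: ereal_inf_lbound; exists C.
  by split => // i; exact: sub_sigma_algebra.
by apply: eq_eseriesr => i _; rewrite /cut hC.
Qed.

Let pre_le d (delta : R) A : (0 < delta)%R -> hausdorff_pre d delta A <= hausdorff d A.
Proof. by move=> d0; apply: ereal_sup_ubound; exists delta. Qed.

Lemma hausdorff_ge0 d A : 0 <= hausdorff d A.
Proof.
apply: le_trans (pre_le d A ltr01).
by rewrite preE//; apply: mu_ext_ge0 => X; exact: cut_ge0.
Qed.

Lemma hausdorff0 d : hausdorff d set0 = 0.
Proof.
apply/eqP; rewrite eq_le hausdorff_ge0 andbT.
apply: ge_ereal_sup => _ [e /= e0 <-]; rewrite preE// mu_ext0//; exact: cut0.
Qed.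

Lemma le_hausdorff d : {homo hausdorff d : A B / A `<=` B >-> A <= B}.
Proof.
move=> A B AB; apply: ge_ereal_sup => _ [e /= e0 <-].
apply: le_trans (pre_le d B e0).
by rewrite preE//; exact: le_mu_ext.
Qed.

Lemma hausdorff_sigma_subadditive d : sigma_subadditive (hausdorff d).
Proof.
move=> F; apply: ge_ereal_sup => _ [e /= e0 <-].
rewrite preE//; apply: le_trans (mu_ext_sigma_subadditive _ _) _.
  by move=> X; exact: cut_ge0.
apply: lee_nneseries => [i _ _|i _].
  by apply: mu_ext_ge0 => X; exact: cut_ge0.
by rewrite -preE//; exact: pre_le.
Qed.

HB.instance Definition _ (d : nat) := isOuterMeasure.Build R V (hausdorff d)
  (hausdorff0 d) (hausdorff_ge0 d) (@le_hausdorff d)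
  (@hausdorff_sigma_subadditive d).

Definition hausdorff_outer (d : nat) : {outer_measure set V -> \bar R} :=
  hausdorff d.

Definition hausdorff_measure (d : nat) :
    {measure set (caratheodory_type (hausdorff_outer d)) -> \bar R} :=
  hausdorff_outer d : set (caratheodory_type (hausdorff_outer d)) -> \bar R.

Definition surface_integral (d : nat) (S : set V) (f : V -> R) : R :=
  (\int[hausdorff_measure d]_(x in S) f x)%R.

End hausdorff.

Section hypersurfaces.
Context {R : realType} {n : nat}.
Local Notation V := 'rV[R]_n.+1.
Implicit Types (U S M Omega : set V) (p : V).

(* U is meant to be open in C1_on and C2_on *)
Definition C1_on (W : normedModType R) U (f : V -> W) :=
  forall x, U x -> differentiable f x /\
    forall v : V, {for x, continuous (fun y => 'D_v f y)}.

Definition C2_on (W : normedModType R) U (f : V -> W) :=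
  C1_on U f /\ forall v : V, C1_on U (fun y => 'D_v f y).

Definition grad (f : V -> R) (x : V) : V := \row_i 'D_(basis_vec i) f x.

Definition frontier (A : set V) : set V := closure A `\` interior A.

Definition defining_function Omega p U (phi : V -> R) :=
  [/\ open U, U p, C2_on U phi, forall x, U x -> grad phi x != 0
    & forall x, U x -> (Omega x <-> phi x < 0)].

Definition C2_boundary Omega := forall p, frontier Omega p ->
  exists U phi, defining_function Omega p U phi.

Definition inward_normal Omega p : V :=
  xget 0 [set nu | exists U phi, defining_function Omega p U phi /\
    nu = - (enorm (grad phi p))^-1 *: grad phi p].

Definition interior_chart M p U (phi : V -> R) :=
  [/\ open U, U p, C2_on U phi, forall x, U x -> grad phi x != 0
    & forall x, U x -> (M x <-> phi x = 0)].

Definition boundary_chart M p U (phi psi : V -> R) :=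
  [/\ open U /\ U p, C2_on U phi /\ C2_on U psi, psi p = 0,
      forall x, U x -> forall a b : R,
        a *: grad phi x + b *: grad psi x = 0 -> a = 0 /\ b = 0
    & forall x, U x -> (M x <-> phi x = 0 /\ psi x <= 0)].

(* compact C^2 hypersurface with (possibly empty) C^2 boundary *)
Definition compact_hypersurface M := compact M /\ forall p, M p ->
  (exists U phi, interior_chart M p U phi) \/
  (exists U phi psi, boundary_chart M p U phi psi).

Definition manifold_boundary M : set V :=
  [set p | M p /\ exists U phi psi, boundary_chart M p U phi psi].

Definition tangent_space M p : set V :=
  [set v | exists U phi, (interior_chart M p U phi \/
      exists psi, boundary_chart M p U phi psi) /\ dot (grad phi p) v = 0].

Definition unit_normal_field M (nu : V -> V) :=
  {within M, continuous nu} /\ forall p, M p ->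
    enorm (nu p) = 1 /\ forall v, tangent_space M p v -> dot (nu p) v = 0.

(* II(u, v) = <nu, D_u W> for any C^1 extension W of v near p that is tangent
   to S along S; on tangent u and v the value does not depend on W. *)
Definition second_form S (nu : V -> V) p (u v : V) : R :=
  xget 0 [set r | exists U (W : V -> V),
    [/\ open U /\ U p, C1_on U W,
        forall q, S q -> U q -> dot (nu q) (W q) = 0, W p = v
      & r = dot (nu p) ('D_u W p)]].

(* |B|^2, the sum of the B(e_j, e_k)^2 over an orthonormal basis of the tangent
   space, computed as the Hilbert-Schmidt norm on R^N of B extended by zero in
   the normal direction *)
Definition second_form_norm2 S (nu : V -> V) p : R :=
  \sum_j \sum_k (second_form S nu p (tproj (nu p) (basis_vec j))
                                    (tproj (nu p) (basis_vec k))) ^+ 2.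

(* Functions on M are represented by functions on R^N of which only the values
   on M matter. *)
Definition C1_extension M (f : V -> R) p (F : V -> R) :=
  exists U, [/\ open U, U p, C1_on U F & forall q, M q -> U q -> F q = f q].

Definition C1_function M (f : V -> R) :=
  forall p, M p -> exists F, C1_extension M f p F.

Definition tangential_grad M (nu : V -> V) (f : V -> R) p : V :=
  xget 0 [set g | exists F, C1_extension M f p F /\
                            g = tproj (nu p) (grad F p)].

End hypersurfaces.

(* The sets into which the l interfaces divide Omega are the npieces connected
   components of their complement; phase assigns each of them to one of the m
   phases. *)
Record partitioning (R : realType) (n : nat) (Omega : set 'rV[R]_n.+1)
    (m l : nat) := Partitioning {
  interface : 'I_l -> set 'rV[R]_n.+1 ;
  normal : 'I_l -> 'rV[R]_n.+1 -> 'rV[R]_n.+1 ;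
  tension : 'I_l -> R ;
  npieces : nat ;
  piece : 'I_npieces -> set 'rV[R]_n.+1 ;
  phase : 'I_npieces -> 'I_m ;
  interface_neq0 : forall i, interface i !=set0 ;
  interface_hypersurface : forall i, compact_hypersurface (interface i) ;
  interface_sub : forall i, interface i `<=` closure Omega ;
  interface_boundary : forall i,
    manifold_boundary (interface i) `<=` frontier Omega ;
  interface_disjoint : forall i j, i != j ->
    interface i `&` interface j = set0 ;
  interface_normal : forall i, unit_normal_field (interface i) (normal i) ;
  tension_gt0 : forall i, 0 < tension i ;
  piece_neq0 : forall a, piece a !=set0 ;
  piece_open : forall a, open (piece a) ;
  piece_connected : forall a, connected (piece a) ;
  piece_disjoint : forall a b, a != b -> piece a `&` piece b = set0 ;
  piece_cover :
    \bigcup_a piece a = Omega `\` \bigcup_i interface i ;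
  phase_surj : forall k, exists a, phase a = k ;
  interface_separates : forall i, exists a b, phase a != phase b /\
    interface i `<=` closure (piece a) `&` closure (piece b) }.

Arguments piece {R n Omega m l} p a : rename.
Arguments phase {R n Omega m l} p a : rename.

Section variations.
Context {R : realType} {n : nat} {Omega : set 'rV[R]_n.+1} {m l : nat}.
Local Notation V := 'rV[R]_n.+1.
Variable M : partitioning Omega m l.

Definition phase_set (k : 'I_m) : set V :=
  \bigcup_(a in [set a | phase M a = k]) piece M a.

Definition connected_partitioning := injective (phase M).

(* flow of a vector field tangent to the boundary of Omega *)
Definition variation (w : V -> V) (Phi : R -> V -> V) :=
  [/\ C1_on setT w,
      forall p, frontier Omega p -> dot (inward_normal Omega p) (w p) = 0,
      forall x, Phi 0 x = x
    & forall t x, is_derive t (1 : R) (fun s => Phi s x) (w (Phi t x))].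

Definition volume_preserving (Phi : R -> V -> V) := forall k : 'I_m,
  \forall t \near (0 : R),
    hausdorff n.+1 (Phi t @` phase_set k) = hausdorff n.+1 (phase_set k).

Definition area (S : 'I_l -> set V) : R :=
  \sum_i tension M i * fine (hausdorff n (S i)).

Definition minimal_partitioning := forall w Phi,
  variation w Phi -> volume_preserving Phi ->
  is_derive (0 : R) (1 : R) (fun t => area (fun i => Phi t @` interface M i)) 0.

Definition interface_second_variation (i : 'I_l) (f : V -> R) : R :=
  surface_integral n (interface M i) (fun x =>
      enorm (tangential_grad (interface M i) (normal M i) f x) ^+ 2
      - second_form_norm2 (interface M i) (normal M i) x * f x ^+ 2)
  - surface_integral n.-1 (manifold_boundary (interface M i)) (fun x =>
      second_form (frontier Omega) (inward_normal Omega) x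
        (normal M i x) (normal M i x) * f x ^+ 2).

Definition second_variation (f : 'I_l -> V -> R) : R :=
  \sum_i tension M i * interface_second_variation i (f i).

Definition interface_admissible (i : 'I_l) (f : V -> R) :=
  C1_function (interface M i) f /\ surface_integral n (interface M i) f = 0.

Definition interface_nonzero (i : 'I_l) (f : V -> R) :=
  exists x, interface M i x /\ f x != 0.

Definition admissible (f : 'I_l -> V -> R) :=
  forall i, interface_admissible i (f i).

Definition stable := forall f, admissible f ->
  (exists i, interface_nonzero i (f i)) -> 0 < second_variation f.

Definition unstable := exists f, admissible f /\ second_variation f < 0.

Definition interface_stable (i : 'I_l) := forall f,
  interface_admissible i f -> interface_nonzero i f ->
  0 < interface_second_variation i f.

Definition interface_unstable (i : 'I_l) := exists f,
  interface_admissible i f /\ interface_second_variation i f < 0.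

End variations.

(* Main.v *)
(* The volume constraints of a connected partitioning decouple, and J is the sum
   of the tension i * J_i, so the equivalences follow by testing J on families
   supported on one interface. This uses J_i(f) = 0 when f vanishes on M_i.
   Since the tangential gradient is chosen among those of all local C^1
   extensions F of f, one has to know that the gradient of an F vanishing on M_i
   is normal to M_i. At p, with M_i = {phi = 0} nearby and v tangent, the
   intermediate value theorem along grad phi gives zeros p + t v + o(t) of phi,
   whence dF(v) = 0; at a boundary point this is done for the inward v, which
   span the tangent hyperplane. *)
Require Import Defs.
From mathcomp Require Import all_boot all_order all_algebra.
From mathcomp Require Import all_classical all_reals all_analysis.
From mathcomp Require Import lra.
Import Order.TTheory GRing.Theory Num.Theory.
Import numFieldNormedType.Exports.
Local Open Scope classical_set_scope.
Local Open Scope ring_scope.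

(** * First-order expansions on the plane through p spanned by v and e *)

Section affine_two_plane.
Context {R : realType} {V : normedModType R}.
Implicit Types (p v e : V) (phi g : V -> R).

Lemma ler_norm_two_plane v e (t s : R) : 0 < t -> `|s| <= t ->
  `|t *: v + s *: e| <= t * (`|v| + `|e| + 1).
Proof.
move=> t0 st; rewrite (le_trans (ler_normD _ _))// !normrZ gtr0_norm//.
have := ler_wpM2r (normr_ge0 e) st; lra.
Qed.

Lemma near_two_plane p v e (U : set V) : nbhs p U ->
  \forall t \near (0 : R)^'+, forall s, `|s| <= t -> U (p + (t *: v + s *: e)).
Proof.
move=> /nbhs_ballP[r /= r0 rU]; set K := `|v| + `|e| + 1.
have K0 : 0 < K by rewrite ltr_wpDl.
near=> t => s st; apply: rU; rewrite -ball_normE /= opprD addNKr normrN.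
have t0 : 0 < t by near: t; exact: nbhs_right_gt.
have : t < r / K by near: t; apply: nbhs_right_lt; rewrite divr_gt0.
rewrite ltr_pdivlMr// => tK; apply: le_lt_trans tK.
exact: ler_norm_two_plane.
Unshelve. all: by end_near. Qed.

(** The estimate is uniform in s: for a single t it controls a whole segment, as the intermediate
    value theorem will require. *)
Lemma near_two_plane_expansion g p v e (eps : R) : differentiable g p -> 0 < eps ->
  \forall t \near (0 : R)^'+, forall s, `|s| <= t ->
    `|g (p + (t *: v + s *: e)) - g p - (t * 'd g p v + s * 'd g p e)|
      <= eps * t.
Proof.
move=> dg eps0; set K := `|v| + `|e| + 1.
have K0 : 0 < K by rewrite ltr_wpDl.
have /eqaddoP/(_ (eps / K)) := diff_locally dg.
rewrite divr_gt0// => /(_ isT) /= H.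
have {}H : \forall x \near p,
    `|g x - g p - 'd g p (x - p)| <= eps / K * `|x - p|.
  rewrite (near_shift 0); apply: filterS H => h /=.
  by rewrite /= subr0 addrK opprD addrA !fctE.
have := @near_two_plane p v e _ H; apply: filterS2 (nbhs_right_gt 0) => t t0 Ht s st.
have := Ht s st; rewrite [p + _ - p]addrAC subrr add0r linearD !linearZ => /le_trans; apply.
rewrite mulrAC ler_pdivrMr// -mulrA (ler_wpM2l (ltW eps0))//.
exact: ler_norm_two_plane.
Qed.

Lemma diff_eq0_tangent phi g p v e (delta : R) :
    (\forall x \near p, differentiable phi x) -> phi p = 0 ->
    'd phi p v = 0 -> 0 < 'd phi p e ->
    differentiable g p -> g p = 0 -> 0 < delta ->
    (\forall t \near (0 : R)^'+, forall s, `|s| <= delta * t ->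
       phi (p + (t *: v + s *: e)) = 0 -> g (p + (t *: v + s *: e)) = 0) ->
  'd g p v = 0.
(* On the segment s in [-eps t, eps t] the function phi changes sign, since its
   increment is s * 'd phi p e + o(t); the zero found there is p + t v + O(eps t),
   so g p = g = 0 forces |'d g p v| = O(eps). *)
Proof.
move=> dphi phip phiv phie dg gp delta0 gphi; apply/eqP/negP => /negP gv.
set L := `|'d g p v|; have L0 : 0 < L by rewrite normr_gt0.
set k := `|'d g p e| + 1; have k0 : 0 < k by rewrite ltr_wpDl.
(* The bound [delta] keeps the zero where [g] is known to vanish, and 1 keeps it where the
   expansions hold. The last bound makes the s-term of [g] at most t * L / 2; with an expansion
   error of t * L / 4 this contradicts L > 0. *)
pose eps := Num.min (Num.min delta 1) (L / (2 * k)).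
have eps0 : 0 < eps by rewrite !lt_min delta0 ltr01 divr_gt0// mulr_gt0.
have epsd : eps <= delta by rewrite !ge_min lexx.
have eps1 : eps <= 1 by rewrite !ge_min lexx orbT.
have epsL : eps * k <= L / 2.
  rewrite -ler_pdivlMr// -mulrA -invfM; by rewrite !ge_min lexx orbT.
have c0 : 0 < eps * 'd phi p e / 2 by rewrite divr_gt0// mulr_gt0.
have L4 : 0 < L / 4 by rewrite divr_gt0.
have [t] : exists t : R, [/\ 0 < t,
   forall s, `|s| <= delta * t ->
       phi (p + (t *: v + s *: e)) = 0 -> g (p + (t *: v + s *: e)) = 0,
   forall s, `|s| <= t -> differentiable phi (p + (t *: v + s *: e)),
   forall s, `|s| <= t ->
    `|phi (p + (t *: v + s *: e)) - phi p - (t * 'd phi p v + s * 'd phi p e)|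
      <= eps * 'd phi p e / 2 * t &
   forall s, `|s| <= t ->
    `|g (p + (t *: v + s *: e)) - g p - (t * 'd g p v + s * 'd g p e)|
      <= L / 4 * t ].
  apply: (@filter_ex _ (0 : R)^'+); near=> t; split; near: t.
  - exact: nbhs_right_gt.
  - exact: gphi.
  - exact: near_two_plane dphi.
  - apply: near_two_plane_expansion => //; exact: nbhs_singleton dphi.
  - exact: near_two_plane_expansion.
rewrite phip gp phiv => -[t0 gphit dphit phit gt].
have et0 : 0 < eps * t by rewrite mulr_gt0.
have et1 : eps * t <= t by rewrite ler_piMl// ltW.
pose h s := phi (p + (t *: v + s *: e)).
(* At s = eps * t and s = - (eps * t) the linear term of [phi] has twice the size of the error
   allowed, so it decides the sign. *)
have hpos : 0 <= h (eps * t).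
  have := phit (eps * t); rewrite gtr0_norm// et1 => /(_ isT).
  rewrite -/(h _) ler_norml => /andP[+ _]; nra.
have hneg : h (- (eps * t)) <= 0.
  have := phit (- (eps * t)); rewrite normrN gtr0_norm// et1 => /(_ isT).
  rewrite -/(h _) ler_norml => /andP[_]; nra.
have [|||s] := @IVT R h (- (eps * t)) (eps * t) 0.
- lra.
- apply: continuous_in_subspaceT => s; rewrite inE /= in_itv /= -ler_norml => hs.
  apply: continuous_comp.
    apply: cvgD; first exact: cvg_cst.
    apply: cvgD; first exact: cvg_cst.
    exact: scalel_continuous.
  apply: differentiable_continuous; apply: dphit; exact: le_trans et1.
- by rewrite ge_min hneg le_max hpos orbT.
rewrite in_itv /= -ler_norml => hs hs0.
have sd : `|s| <= delta * t by rewrite (le_trans hs)// ler_wpM2r// ltW.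
have := gt s (le_trans hs et1); rewrite (gphit _ sd hs0) subrr sub0r normrN.
move=> gle; have : `|t * 'd g p v| <= L / 4 * t + `|s * 'd g p e|.
  rewrite -[t * _](addrK (s * 'd g p e)).
  by rewrite (le_trans (ler_normB _ _))// lerD2r.
rewrite !normrM gtr0_norm// -/L.
have : `|s| * `|'d g p e| <= eps * t * k.
  by rewrite ler_pM// /k lerDl.
nra.
Unshelve. all: by end_near. Qed.

End affine_two_plane.

(** * Euclidean orthogonality and normal directions *)

Section dot_theory.
Context {R : realType} {N : nat}.
Implicit Types (u v w nu : 'rV[R]_N) (a : R).

Lemma dotC u v : dot u v = dot v u.
Proof. by apply: eq_bigr => i _; rewrite mulrC. Qed.

Lemma dotDr w u v : dot w (u + v) = dot w u + dot w v.
Proof. by rewrite -big_split; apply: eq_bigr => i _; rewrite mxE mulrDr. Qed.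

Lemma dotZr w a v : dot w (a *: v) = a * dot w v.
Proof. by rewrite big_distrr; apply: eq_bigr => i _; rewrite mxE mulrCA. Qed.

Lemma dotBr w u v : dot w (u - v) = dot w u - dot w v.
Proof. by rewrite dotDr -scaleN1r dotZr mulN1r. Qed.

Lemma dot_ge0 u : 0 <= dot u u.
Proof. by apply: sumr_ge0 => i _; rewrite -expr2 sqr_ge0. Qed.

Lemma dot_eq0 u : (dot u u == 0) = (u == 0).
Proof.
apply/idP/eqP => [|->]; last by rewrite /dot big1// => i _; rewrite mxE mul0r.
rewrite psumr_eq0; last by move=> i _; rewrite -expr2 sqr_ge0.
move=> /allP u0; apply/rowP => i; rewrite mxE; apply/eqP.
by have := u0 i (mem_index_enum i); rewrite mulf_eq0 orbb.
Qed.

Lemma dot_gt0 u : (0 < dot u u) = (u != 0).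
Proof. by rewrite lt_def dot_ge0 andbT dot_eq0. Qed.

Lemma dot_unit u : enorm u = 1 -> dot u u = 1.
Proof. by move=> u1; rewrite -[LHS]sqr_sqrtr ?dot_ge0// -/(enorm u) u1 expr1n. Qed.

Lemma dot_reject u v : u != 0 ->
  dot u (v - (dot u v / dot u u) *: u) = 0.
Proof. by move=> u0; rewrite dotBr dotZr divfK ?subrr// dot_eq0. Qed.

(** The component w of v orthogonal to u is also orthogonal to v by hypothesis, hence to itself. *)
Lemma orth_colinear u v : u != 0 ->
  (forall w, dot u w = 0 -> dot v w = 0) -> v = (dot u v / dot u u) *: u.
Proof.
move=> u0 uv; have uw := dot_reject u v u0.
apply/eqP; rewrite -subr_eq0 -dot_eq0.
set w := v - _ in uw *; rewrite {2}/w dotBr dotZr.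
by rewrite [dot w u]dotC uw mulr0 subr0 dotC uv.
Qed.

(** Both [nu] and [w] are multiples of [u], and the multiple for [nu] is nonzero, so [w] is parallel
    to [nu]. In the application [u] is the gradient of a chart function and [w] that of an
    extension. *)
Lemma tproj_eq0 u nu w : u != 0 -> enorm nu = 1 ->
  (forall v, dot u v = 0 -> dot nu v = 0) ->
  (forall v, dot u v = 0 -> dot w v = 0) -> tproj nu w = 0.
Proof.
move=> u0 /dot_unit nu1 /(orth_colinear _ _ u0) nuE /(orth_colinear _ _ u0) wE.
set c := _ / _ in nuE; set d := _ / _ in wE.
have c0 : c != 0.
  apply/eqP => c0; move: nu1; rewrite nuE c0 dotZr mul0r => /eqP.
  by rewrite eq_sym oner_eq0.
have wnu : w = (d / c) *: nu by rewrite nuE scalerA divfK.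
by rewrite /tproj dotC wnu dotZr nu1 mulr1 subrr.
Qed.

End dot_theory.

(** * Gradients of functions vanishing on a hypersurface *)

Section vanishing_on_hypersurface.
Context {R : realType} {n : nat}.
Local Notation V := 'rV[R]_n.+1.
Implicit Types (M U : set V) (p v : V) (F phi psi : V -> R).

Lemma dot_grad F p v : differentiable F p -> dot (grad F p) v = 'd F p v.
Proof.
move=> dF; rewrite [in RHS](row_sum_delta v) linear_sum; apply: eq_bigr => i _.
by rewrite mxE deriveE// linearZ mulrC.
Qed.

Lemma near_C2_differentiable (U : set V) phi p : open U -> U p -> C2_on U phi ->
  \forall x \near p, differentiable phi x.
Proof.
move=> oU Up [c1 _]; apply: filterS (open_nbhs_nbhs (conj oU Up)) => x Ux.
by have [] := c1 x Ux.
Qed.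

(** Every zero of [phi] in [U] lies on [M], so [diff_eq0_tangent] applies with [e] the gradient of
    [phi] and [delta] = 1. *)
Lemma interior_grad_orth M p U phi F v : interior_chart M p U phi -> M p ->
  differentiable F p -> (\forall q \near p, M q -> F q = 0) ->
  dot (grad phi p) v = 0 -> dot (grad F p) v = 0.
Proof.
move=> [oU Up c2 phi0 Mphi] Mp dF F0.
have dphi := near_C2_differentiable _ _ _ oU Up c2.
have dphip := nbhs_singleton dphi.
rewrite !dot_grad// => phiv.
have UF : nbhs p (U `&` [set q | M q -> F q = 0]).
  by apply: filterI => //; exact: open_nbhs_nbhs.
apply: (diff_eq0_tangent phi F p v (grad phi p) 1) => //.
- exact/Mphi.
- by rewrite -dot_grad// dot_gt0; exact: phi0.
- exact: (nbhs_singleton F0).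
- have := near_two_plane p v (grad phi p) _ UF; apply: filterS => t H s.
  by rewrite mul1r => /H[Uq Fq] phiq; apply: Fq; exact/Mphi.
Qed.

Lemma boundary_grad_orth M p U phi psi F v :
  boundary_chart M p U phi psi -> M p ->
  differentiable F p -> (\forall q \near p, M q -> F q = 0) ->
  dot (grad phi p) v = 0 -> dot (grad F p) v = 0.
Proof.
move=> [[oU Up] [c2 c2'] psip indep Mphi] Mp dF F0.
have dphi := near_C2_differentiable _ _ _ oU Up c2.
have dphip := nbhs_singleton dphi.
have dpsip := nbhs_singleton (near_C2_differentiable _ _ _ oU Up c2').
have phip : phi p = 0 by have /Mphi[] := Mp.
have UF : nbhs p (U `&` [set q | M q -> F q = 0]).
  by apply: filterI => //; exact: open_nbhs_nbhs.
have a0 : grad phi p != 0.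
  apply/eqP => a0; have [] := indep p Up 1 0; last by move=> /eqP; rewrite oner_eq0.
  by rewrite a0 scaler0 scale0r addr0.
set e := grad phi p in a0 *.
(* Only directions pointing strictly inside M are reached by nearby points of M;
   they still span the tangent hyperplane. *)
have inward u : dot e u = 0 -> dot (grad psi p) u < 0 -> dot (grad F p) u = 0.
  rewrite !dot_grad// => phiu psiu.
  set k := `|'d psi p e| + 1; have k0 : 0 < k by rewrite ltr_wpDl.
  (* Along t u the function [psi] drops by 2 c t to first order. The s-term, for |s| <= delta t, and
     the expansion error each give back at most c t, so [psi] stays nonpositive and the zeros of
     [phi] found there lie on [M]. *)
  pose c := - 'd psi p u / 2; have c0 : 0 < c by rewrite /c; lra.
  pose delta := Num.min 1 (c / k).
  have delta0 : 0 < delta by rewrite lt_min ltr01 divr_gt0.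
  have delta1 : delta <= 1 by rewrite ge_min lexx.
  have deltak : delta * k <= c by rewrite -ler_pdivlMr// ge_min lexx orbT.
  apply: (diff_eq0_tangent phi F p u e delta) => //.
  - by rewrite -dot_grad// dot_gt0.
  - exact: (nbhs_singleton F0).
  - near=> t => s sd phiq.
    have t0 : 0 < t by near: t; exact: nbhs_right_gt.
    have st : `|s| <= t by rewrite (le_trans sd)// ler_piMl// ltW.
    have [Uq Fq] : (U `&` [set q | M q -> F q = 0]) (p + (t *: u + s *: e)).
      by move: s st {sd phiq}; near: t; exact: near_two_plane.
    apply: Fq; apply/Mphi => //; split => //.
    have : `|psi (p + (t *: u + s *: e)) - psi p - (t * 'd psi p u + s * 'd psi p e)|
      <= c * t.
      by move: s st {sd phiq Uq}; near: t; exact: near_two_plane_expansion.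
    rewrite psip subr0 ler_norml => /andP[_].
    have : s * 'd psi p e <= delta * t * k.
      rewrite (le_trans (ler_norm _))// normrM ler_pM// /k lerDl//.
    rewrite /c in deltak *; nra.
(* This is minus the part of the gradient of [psi] orthogonal to [e]: nonzero by independence of the
   two gradients, and [psi] has slope - |w|^2 along it. *)
move=> ev; pose w := dot e (grad psi p) / dot e e *: e - grad psi p.
have ew : dot e w = 0.
  by rewrite /w -opprB -scaleN1r dotZr dot_reject// mulr0.
have w0 : w != 0.
  apply/eqP => w0; have [] := indep p Up (dot e (grad psi p) / dot e e) (-1).
    by rewrite scaleN1r.
  by move=> _ /eqP; rewrite oppr_eq0 oner_eq0.
have psiw : dot (grad psi p) w < 0.
  have -> : grad psi p = (dot e (grad psi p) / dot e e) *: e - w.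
    by rewrite /w opprB addrC subrK.
  by rewrite dotC dotBr dotZr (dotC w e) ew mulr0 sub0r oppr_lt0 dot_gt0.
(* With this k the slope of [psi] along v + k w is at most -1, so v is a combination of the inward
   vectors v + k w and w. *)
pose k := (`|dot (grad psi p) v| + 1) / - dot (grad psi p) w.
have : dot (grad F p) (v + k *: w) = 0.
  apply: inward; first by rewrite dotDr dotZr ev ew mulr0 addr0.
  rewrite dotDr dotZr /k invrN mulrN mulNr divfK ?lt_eqF//.
  have := ler_norm (dot (grad psi p) v); lra.
by rewrite dotDr dotZr (inward w)// mulr0 addr0.
Unshelve. all: by end_near. Qed.

(** Any local extension of f vanishes on [M] near p, so its gradient is parallel to [nu p] and
    projects to 0. *)
Lemma tangential_grad_eq0 M nu f p : compact_hypersurface M ->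
  unit_normal_field M nu -> (forall q, M q -> f q = 0) -> M p ->
  tangential_grad M nu f p = 0.
Proof.
move=> [_ Mchart] [_ /(_ p) nuM] f0 Mp; rewrite /tangential_grad.
(* If f has no C^1 extension at p, the default value of [xget] is already 0. *)
case: xgetP => // g _ [F [[W [oW Wp c1 Ff]] ->]].
have [nu1 nuT] := nuM Mp; have [dF _] := c1 p Wp.
have F0 : \forall q \near p, M q -> F q = 0.
  apply: filterS (open_nbhs_nbhs (conj oW Wp)) => q Wq Mq.
  by rewrite Ff// f0.
have [[U [phi ch]]|[U [phi [psi ch]]]] := Mchart p Mp.
- apply: (tproj_eq0 (grad phi p)) => //.
  + by case: ch => _ Up _ + _; apply.
  + by move=> v pv; apply: nuT; exists U, phi; split => //; left.
  + by move=> v; exact: (interior_grad_orth _ _ _ _ _ _ ch).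
- apply: (tproj_eq0 (grad phi p)) => //.
  + apply/eqP => a0; case: ch => -[_ Up] _ _ /(_ p Up 1 0) indep _.
    have [] := indep; last by move=> /eqP; rewrite oner_eq0.
    by rewrite a0 scaler0 scale0r addr0.
  + by move=> v pv; apply: nuT; exists U, phi; split => //; right; exists psi.
  + by move=> v; exact: (boundary_grad_orth _ _ _ _ _ _ _ ch).
Qed.

Lemma surface_integral_eq0 d (S : set V) (f : V -> R) :
  (forall x, S x -> f x = 0) -> surface_integral d S f = 0.
Proof.
move=> f0; rewrite /surface_integral (@eq_Rintegral _ _ _ _ _ (cst 0)).
  by rewrite /Rintegral integral0.
by move=> x; rewrite inE => /f0.
Qed.

End vanishing_on_hypersurface.

(** * Decoupling of the interfaces *)

Section extension_by_zero.
Context {R : realType} {n : nat} {Omega : set 'rV[R]_n.+1} {m l : nat}.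
Local Notation V := 'rV[R]_n.+1.
Variable M : partitioning Omega m l.
Implicit Types (i : 'I_l) (f : V -> R).

Lemma interface_second_variation_eq0 i f :
  (forall x, interface M i x -> f x = 0) -> interface_second_variation M i f = 0.
Proof.
move=> f0; rewrite /interface_second_variation !surface_integral_eq0 ?subrr//.
  by move=> x [Mx _]; rewrite f0// expr0n mulr0.
move=> x Mx; rewrite tangential_grad_eq0//; last 2 first.
- exact: interface_hypersurface.
- exact: interface_normal.
rewrite f0// /enorm; have /eqP-> : dot (0 : V) 0 == 0 by rewrite dot_eq0.
by rewrite sqrtr0 expr0n mulr0 subrr.
Qed.

Lemma interface_admissible0 i : interface_admissible M i (cst 0).
Proof.
split; last exact: surface_integral_eq0.
move=> p Mp; exists (cst 0), setT; split => //; first exact: openT.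
move=> x _; split; first exact: differentiable_cst.
move=> v; have -> : (fun y => 'D_v (cst 0 : V -> R) y) = cst 0.
  by apply/funext => y; rewrite derive_cst.
exact: cst_continuous.
Qed.

Definition extend_by_zero i f (j : 'I_l) : V -> R := if j == i then f else cst 0.

Lemma admissible_extend_by_zero i f :
  interface_admissible M i f -> admissible M (extend_by_zero i f).
Proof.
move=> fi j; rewrite /extend_by_zero; case: eqP => [->//|_].
exact: interface_admissible0.
Qed.

Lemma second_variation_extend_by_zero i f :
  second_variation M (extend_by_zero i f) =
  tension M i * interface_second_variation M i f.
Proof.
rewrite /second_variation (bigD1 i)//= {1}/extend_by_zero eqxx big1 ?addr0//.
move=> j /negbTE ji; rewrite /extend_by_zero ji.
by rewrite interface_second_variation_eq0 ?mulr0.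
Qed.

Lemma stable_interfaces : stable M <-> forall i, interface_stable M i.
Proof.
split=> [st i f fi fn0|st f fa [i fi]].
  rewrite -(pmulr_rgt0 _ (tension_gt0 M i)) -second_variation_extend_by_zero.
  apply: st; first exact: admissible_extend_by_zero.
  by exists i; rewrite /extend_by_zero eqxx.
(* Stability of M_j says nothing about a component vanishing on M_j; such a component contributes 0.
   Strict positivity comes from the nonzero component i. *)
have J0 j : 0 <= tension M j * interface_second_variation M j (f j).
  rewrite pmulr_rge0 ?tension_gt0//.
  have [fj|fj] := pselect (interface_nonzero M j (f j)).
    by rewrite ltW// st.
  rewrite interface_second_variation_eq0// => x Mx.
  by apply: contra_notP fj => /eqP fx; exists x.
rewrite /second_variation (bigD1 i)//= ltr_pwDl ?sumr_ge0//.
by rewrite pmulr_rgt0 ?tension_gt0// st.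
Qed.

Lemma unstable_interface : unstable M <-> exists i, interface_unstable M i.
Proof.
split=> [[f [fa Jf]]|[i [f [fi Jf]]]].
  (* If no interface is unstable, each f_i, being admissible on its own, gives a nonnegative term,
     and J cannot be negative. *)
  apply: contraPP Jf => /forallNP noti; apply/negP; rewrite -leNgt.
  apply: sumr_ge0 => i _; rewrite pmulr_rge0 ?tension_gt0// leNgt.
  by apply/negP => Ji; apply: (noti i); exists (f i).
exists (extend_by_zero i f); split; first exact: admissible_extend_by_zero.
by rewrite second_variation_extend_by_zero pmulr_rlt0 ?tension_gt0.
Qed.

End extension_by_zero.

Theorem proposition18 (R : realType) (n m : nat) (Omega : set 'rV[R]_n.+1)
    (Omega_open : open Omega) (Omega_bounded : bounded_set Omega)
    (Omega_connected : connected Omega) (Omega_C2 : C2_boundary Omega)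
    (M : partitioning Omega m m.-1)
    (M_connected : connected_partitioning M)
    (M_minimal : minimal_partitioning M) :
  (stable M <-> forall i : 'I_m.-1, interface_stable M i) /\
  (unstable M <-> exists i : 'I_m.-1, interface_unstable M i).
Proof. split; [exact: stable_interfaces | exact: unstable_interface]. Qed.
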